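(* Let $X$ be a Banach space, $u:\mathbb{R}\to X$ an analytic function, $m$ a nonnegative integer and $k>0$ a real number. For any integer $p\ge m$ and any real $t$, we can write $$u^{(m)}(t)=k^{-m}\sum_{i=m}^p\ \sum_{|\alpha^i|=i}C_{\alpha^i}(k_i)^iD^{\alpha^i}u(t)+O(k^{p+1-m}),$$ where the $C_{\alpha^i}$ are constants (not depending on $u$, $t$ or $k$), $k_m=k$, $k_i=\varepsilon_ik$ for $i\ge m+1$ with $\varepsilon_i>0$ arbitrarily chosen, and each finite difference operator $D^{\alpha^i}$ is related to the spacing $k_i$ in the sense that $$(k_i)^iD^{\alpha^i}u(t)=\sum_{j=0}^i(-1)^j\binom{i}{j}u\bigl(t+(\alpha^i_1-j)k_i\bigr),\qquad\text{for }|\alpha^i|=i.$$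
   Context: For each $i$, $\alpha^i=(\alpha^i_1,\alpha^i_2)\in\{0,1,\dots,i\}\times\{0,1,\dots,i\}$ is a double index, $|\alpha^i|=\alpha^i_1+\alpha^i_2$, and $D^{\alpha^i}=D_+^{\alpha^i_1}D_-^{\alpha^i_2}$, where $D_+v(t)=\frac{v(t+h)-v(t)}{h}$ and $D_-v(t)=\frac{v(t)-v(t-h)}{h}$ are the forward and backward difference operators with spacing $h=k_i$. The inner sum ranges over all double indices $\alpha^i$ with $|\alpha^i|=i$ (some constants $C_{\alpha^i}$ may be zero). The $O(\cdot)$ is as $k\to0$, for fixed $u$, $t$, $m$, $p$ and fixed $\varepsilon_i$. *)

(* Defs.v *)
From HB Require Import structures.
From mathcomp Require Import all_boot all_order all_algebra.
From mathcomp Require Import all_classical all_reals all_analysis.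
Import Order.TTheory GRing.Theory Num.Theory.
Import numFieldNormedType.Exports.

Set Implicit Arguments.
Unset Strict Implicit.
Unset Printing Implicit Defensive.

Local Open Scope classical_set_scope.
Local Open Scope ring_scope.

Definition analytic (R : realType) (X : normedModType R) (u : R -> X) : Prop :=
  forall t0 : R, exists a : nat -> X, \forall t \near t0,
    series (fun n => (t - t0) ^+ n *: a n) @ \oo --> u t.

Definition forward_diff (R : realType) (X : normedModType R) (h : R)
  (v : R -> X) : R -> X := fun t => h^-1 *: (v (t + h) - v t).

Definition backward_diff (R : realType) (X : normedModType R) (h : R)
  (v : R -> X) : R -> X := fun t => h^-1 *: (v t - v (t - h)).

(* The constraint |alpha| = i is not part of this index set: it is imposed where
   alpha is quantified or summed over. *)
Notation double_index i := ('I_i.+1 * 'I_i.+1)%type (only parsing).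

Definition weight (i : nat) (alpha : double_index i) : nat :=
  (alpha.1 + alpha.2)%N.

Definition finite_diff (R : realType) (X : normedModType R) (h : R) (i : nat)
  (alpha : double_index i) (v : R -> X) : R -> X :=
  iter alpha.1 (forward_diff h) (iter alpha.2 (backward_diff h) v).

Definition spacing (R : realType) (m : nat) (eps : nat -> R) (k : R)
  (i : nat) : R := if i == m then k else eps i * k.

(* Main.v *)
(* Only the forward differences alpha = (i, 0) receive a nonzero constant.
   The operator k_i^i D^alpha annihilates polynomials of degree less than i and
   maps s^i to i! k_i^i, so the conditions that the Taylor coefficients of order
   m..p be reproduced exactly form a triangular linear system with nonzero
   diagonal for the constants; those of order less than m vanish automatically.
   What remains is the Taylor remainder of order p+1, divided by k^m.  That the
   n-th Taylor coefficient is u^(n)(t) / n! is proved by differentiating the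
   power series termwise: its partial sums have second-order errors
   K (y - x)^2 with K uniform in the number of terms. *)
Require Import Defs.
From HB Require Import structures.
From mathcomp Require Import all_boot all_order all_algebra.
From mathcomp Require Import all_classical all_reals all_analysis.
From mathcomp Require Import ring lra.
Import Order.TTheory GRing.Theory Num.Theory.
Import numFieldNormedType.Exports.

Local Open Scope classical_set_scope.
Local Open Scope ring_scope.

(** * Alternating binomial sums and iterated differences *)

Lemma alternating_sum_pascal (R : pzRingType) (X : lmodType R) (i : nat)
    (f : nat -> X) :
  \sum_(0 <= j < i.+1) ((-1) ^+ j * 'C(i, j)%:R) *: f j -
  \sum_(0 <= j < i.+1) ((-1) ^+ j * 'C(i, j)%:R) *: f j.+1 =
  \sum_(0 <= j < i.+2) ((-1) ^+ j * 'C(i.+1, j)%:R) *: f j.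
Proof.
rewrite [RHS]big_nat_recl// bin0.
under [in RHS]eq_bigr do rewrite binS natrD mulrDr scalerDl.
rewrite big_split/= [in RHS]addrA; congr (_ + _); last first.
  by rewrite -sumrN; apply: eq_bigr => j _; rewrite exprS !mulN1r mulNr scaleNr.
rewrite big_nat_recl// bin0; congr (_ + _).
by rewrite big_nat_recr//= bin_small// mulr0 scale0r addr0.
Qed.

(** Each step of either operator yields h^-1 times the difference of two copies of the sum, the
    second being the first with j replaced by j + 1. In a forward step the first copy is shifted by
    h, which turns a into a + 1. [alternating_sum_pascal] merges the copies. *)
Lemma iter_diffE (R : realType) (X : normedModType R) (h : R) (h0 : h != 0)
    (a b : nat) (v : R -> X) (t : R) :
  h ^+ (a + b) *: iter a (forward_diff h) (iter b (backward_diff h) v) t =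
  \sum_(0 <= j < (a + b).+1) ((-1) ^+ j * 'C(a + b, j)%:R) *:
    v (t + (a%:R - j%:R) * h).
Proof.
elim: a t => [|a IHa] t.
  rewrite add0n /=; elim: b t => [|b IHb] t.
    by rewrite big_nat1 bin0 expr0 mulr1 !scale1r subrr mul0r addr0.
  rewrite /= /backward_diff exprSr scalerA mulfK// scalerBr !IHb.
  rewrite -alternating_sum_pascal; congr (_ - _).
  apply: eq_bigr => j _; congr (_ *: v _).
  by rewrite -[in RHS]natr1; ring.
rewrite addSn /= /forward_diff exprSr scalerA mulfK// scalerBr !IHa.
rewrite -alternating_sum_pascal; congr (_ - _); apply: eq_bigr => j _;
  congr (_ *: v _); rewrite -!natr1; ring.
Qed.

(** Induction on n, splitting off one factor x - j. The part with x has degree below the order of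
    the difference and vanishes; in the part with j, the absorption j C(i+1, j) = (i+1) C(i, j-1)
    lowers both order and degree by one. *)
Lemma alternating_sum_expr (R : comRingType) (i n : nat) (x : R) :
  (n <= i)%N ->
  \sum_(0 <= j < i.+1) (-1) ^+ j * 'C(i, j)%:R * (x - j%:R) ^+ n =
  if n == i then n`!%:R else 0.
Proof.
elim: n i x => [|n IHn] i x.
  move=> _; under eq_bigr do rewrite expr0 mulr1.
  case: i => [|i]; first by rewrite big_nat1 bin0 mulr1.
  transitivity ((1 - 1 : R) ^+ i.+1); last by rewrite subrr expr0n.
  rewrite exprDn big_mkord; apply: eq_bigr => j _.
  by rewrite expr1n mul1r mulr_natr.
case: i => [//|i]; rewrite ltnS => ni.
have -> : \sum_(0 <= j < i.+2) (-1) ^+ j * 'C(i.+1, j)%:R * (x - j%:R) ^+ n.+1 =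
  x * \sum_(0 <= j < i.+2) (-1) ^+ j * 'C(i.+1, j)%:R * (x - j%:R) ^+ n +
  i.+1%:R * \sum_(0 <= j < i.+1) (-1) ^+ j * 'C(i, j)%:R * (x - 1 - j%:R) ^+ n.
  have -> : i.+1%:R * \sum_(0 <= j < i.+1)
        (-1) ^+ j * 'C(i, j)%:R * (x - 1 - j%:R) ^+ n =
      - \sum_(0 <= j < i.+2)
        (-1) ^+ j * (j * 'C(i.+1, j))%:R * (x - j%:R) ^+ n :> R.
    rewrite [in RHS]big_nat_recl// mul0n mulr0 mul0r add0r mulr_sumr -sumrN.
    apply: eq_bigr => j _; rewrite -mul_bin_diag natrM exprS.
    have -> : x - j.+1%:R = x - 1 - j%:R by rewrite -natr1; ring.
    ring.
  rewrite mulr_sumr -sumrB; apply: eq_bigr => j _.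
  rewrite natrM exprS; ring.
rewrite !IHn ?(leq_trans ni)// eqSS [n == i.+1]ltn_eqF ?ltnS// mulr0 add0r.
by case: eqP => [->|_]; rewrite ?mulr0// factS natrM.
Qed.

(** * Triangular linear systems, by forward substitution *)

Lemma lower_triangular_solve (F : fieldType) (A : nat -> nat -> F)
    (b : nat -> F) (m p : nat) : (forall n, (m <= n)%N -> A n n != 0) ->
  exists d : nat -> F, forall n, (m <= n <= p)%N ->
    \sum_(m <= i < n.+1) d i * A n i = b n.
Proof.
move=> A0; elim: p => [|p [d dP]].
  (* Only m = n = 0 can occur here, so a constant sequence will do. *)
  exists (fun=> b 0%N / A 0%N 0%N) => n /andP[mn]; rewrite leqn0 => /eqP n0.
  move: mn; rewrite n0 leqn0 => /eqP m0.
  by rewrite m0 big_nat1 divfK// A0// m0.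
(* The unknown [r] is read off the new row; earlier rows do not involve it. *)
pose r := (b p.+1 - \sum_(m <= i < p.+1) d i * A p.+1 i) / A p.+1 p.+1.
exists (fun i => if i == p.+1 then r else d i) => n /andP[mn].
have old k : (k <= p.+1)%N -> \sum_(m <= i < k)
    (if i == p.+1 then r else d i) * A n i = \sum_(m <= i < k) d i * A n i.
  move=> kp; apply: eq_big_nat => i /andP[_ ik].
  by rewrite ltn_eqF// (leq_trans ik).
rewrite leq_eqVlt => /predU1P[np|np].
  rewrite big_nat_recr//= old ?np// eqxx /r -np divfK ?A0// addrC subrK//.
by rewrite old// dP// mn.
Qed.

(** * Power series with coefficients in a Banach space *)

Section PowerSeries.
Context {R : realType} {X : completeNormedModType R}.
Implicit Types (u : R -> X) (a b : nat -> X) (t s rho M : R).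

(** The clause of [analytic] at one point, with the coefficients named so that differentiation can
    act on them. *)
Definition expands_at u t a :=
  \forall t' \near t, series (fun n => (t' - t) ^+ n *: a n) @ \oo --> u t'.

Lemma geometric_sum_bound b (B : R) (N : nat) : 0 <= B ->
  (forall n, `|b n| <= geometric B 2^-1 n) ->
  `|\sum_(0 <= n < N) b n| <= 2 * B.
Proof.
move=> B0 bB; apply: le_trans (ler_norm_sum _ _ _) _.
apply: (@le_trans _ _ (series (geometric B 2^-1) N)).
  by apply: ler_sum => n _; exact: bB.
apply: le_trans (geometric_le_lim _ _ _ _) _ => //.
  by rewrite ger0_norm// invf_lt1// ltr1n.
have -> : 1 - 2^-1 = 2^-1 :> R by field.
by rewrite invrK mulrC.
Qed.

Lemma is_cvg_geometric_bound b (B : R) : 0 <= B ->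
  (forall n, `|b n| <= geometric B 2^-1 n) -> cvgn (series b).
Proof.
move=> B0 bB; apply: normed_cvg; apply: (series_le_cvg _ _ bB) => //.
  by move=> n; apply: geometric_ge0.
by apply: is_cvg_geometric_series; rewrite ger0_norm// invf_lt1// ltr1n.
Qed.

Lemma cvg_norm_le (f : nat -> X) (l : X) (B : R) (n0 : nat) :
  f @ \oo --> l -> (forall n, (n0 <= n)%N -> `|f n| <= B) -> `|l| <= B.
Proof.
move=> fl fB; apply: (ler_cvg_to (cvg_norm fl) (cvg_cst B)).
by exists n0.
Qed.

(** Convergence at the single point t + rho sends rho^n a_n to 0, which bounds these terms by some
    M. Halving the radius keeps the closed ball of radius rho inside the neighbourhood. *)
Lemma expands_at_bound u t a : expands_at u t a ->
  exists rho M : R, [/\ 0 < rho, 0 <= M,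
    forall n, `|a n| * rho ^+ n <= M &
    forall s, `|s| <= rho ->
      series (fun n => s ^+ n *: a n) @ \oo --> u (t + s)].
Proof.
case/nbhs_ballP => r /= r0 H.
have rho0 : 0 < r / 2 by rewrite divr_gt0.
have cv s : `|s| <= r / 2 ->
    series (fun n => s ^+ n *: a n) @ \oo --> u (t + s).
  move=> sr; have /H : ball t r (t + s).
    by rewrite -ball_normE /= opprD addNKr normrN; lra.
  by rewrite /= addrAC subrr add0r.
have /cvgP/cvg_series_cvg_0 c0 :
    series (fun n => (r / 2) ^+ n *: a n) @ \oo --> u (t + r / 2).
  by apply: cv; rewrite gtr0_norm.
have [M [_ HM]] := cvg_seq_bounded (cvgP _ c0).
exists (r / 2), (`|M| + 1); split => //.
move=> n; have : `|(r / 2) ^+ n *: a n| <= `|M| + 1.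
  by apply: HM => //; rewrite (le_lt_trans (ler_norm _))// ltrDl.
by rewrite normrZ normrX gtr0_norm// mulrC.
Qed.

Lemma expands_at_value u t a : expands_at u t a -> u t = a 0%N.
Proof.
move=> /expands_at_bound[rho [M [rho0 _ _ /(_ 0)]]].
rewrite normr0 addr0 => /(_ (ltW rho0)) cu.
apply: (@cvg_unique _ (@norm_hausdorff _ X) _ _ _ _ cu).
rewrite /= -cvg_shiftS; apply: cvg_near_cst; near=> n.
rewrite /= /series /= big_nat_recl// expr0 scale1r big1 ?addr0// => i _.
by rewrite expr0n scale0r.
Unshelve. all: by end_near. Qed.

(** For |s| <= rho/2 the term of index n + q is at most (M / rho^q) |s|^q 2^-n; the geometric sum
    gives the factor 2. *)
Lemma taylor_remainder u t a (q : nat) : expands_at u t a ->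
  exists B delta : R, 0 < delta /\ forall s, `|s| <= delta ->
    `|u (t + s) - \sum_(0 <= n < q) s ^+ n *: a n| <= B * `|s| ^+ q.
Proof.
move=> /expands_at_bound[rho [M [rho0 M0 aM cu]]].
exists (2 * (M / rho ^+ q)), (rho / 2).
split=> [|s sr]; first by rewrite divr_gt0.
have srho : `|s| <= rho by lra.
have cv : (fun N => series (fun n => s ^+ n *: a n) N -
    \sum_(0 <= n < q) s ^+ n *: a n) @ \oo -->
    u (t + s) - \sum_(0 <= n < q) s ^+ n *: a n.
  by apply: cvgB; [exact: cu | exact: cvg_cst].
apply: (@cvg_norm_le _ _ _ q cv) => N qN.
rewrite /series /= (big_cat_nat (leq0n q) qN)//= addrAC subrr add0r -{1}[q]add0n big_addn.
rewrite -mulrA; apply: geometric_sum_bound => [|n].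
  by rewrite mulr_ge0 ?divr_ge0 ?exprn_ge0// ltW.
rewrite normrZ normrX /=.
have x0 : 0 <= `|s| / rho by rewrite divr_ge0// ltW.
have xn : (`|s| / rho) ^+ n <= 2^-1 ^+ n.
  by rewrite lerXn2r ?nnegrE// ?invr_ge0// ler_pdivrMr// mulrC.
have -> : `|s| ^+ (n + q) * `|a (n + q)%N| =
    (`|s| / rho) ^+ n * ((`|s| / rho) ^+ q * (`|a (n + q)%N| * rho ^+ (n + q))).
  by rewrite !expr_div_n !exprD; field; rewrite !expf_neq0 ?gt_eqF.
have -> : M / rho ^+ q * `|s| ^+ q * 2^-1 ^+ n =
    2^-1 ^+ n * ((`|s| / rho) ^+ q * M).
  by rewrite expr_div_n; ring.
by rewrite ler_pM ?mulr_ge0 ?exprn_ge0 ?ler_wpM2l ?exprn_ge0// ltW.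
Qed.

(* Induction on n via D_(n+1) = y D_n + n x^(n-1) (y - x)^2. *)
Lemma exprn_second_order rho (x y : R) (n : nat) : 0 < rho ->
  `|x| <= rho / 4 -> `|y| <= rho / 4 ->
  `|y ^+ n - x ^+ n - (y - x) * (n%:R * x ^+ n.-1)| <=
    16 * (y - x) ^+ 2 / rho ^+ 2 * (rho ^+ n * 2^-1 ^+ n).
Proof.
move=> rho0 xr yr.
have h0 : 0 <= (y - x) ^+ 2 by exact: sqr_ge0.
have x0 := normr_ge0 x; have y0 := normr_ge0 y.
have Q0 : 0 <= 16 * (y - x) ^+ 2 / rho ^+ 2.
  by rewrite divr_ge0 ?sqr_ge0// mulr_ge0.
elim: n => [|n IHn].
  by rewrite !expr0 mul0r mulr0 !subrr normr0 !mulr1.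
have -> : y ^+ n.+1 - x ^+ n.+1 - (y - x) * (n.+1%:R * x ^+ n) =
    y * (y ^+ n - x ^+ n - (y - x) * (n%:R * x ^+ n.-1)) +
    (y - x) ^+ 2 * (n%:R * x ^+ n.-1).
  by case: n {IHn} => [|n]; rewrite /= ?expr0 ?expr1 -?natr1 ?exprS; ring.
apply: le_trans (ler_normD _ _) _; rewrite [`|y * _|]normrM [`|_ ^+ 2 * _|]normrM.
rewrite (ger0_norm h0) [`|n%:R * _|]normrM normr_nat normrX.
set Q := 16 * _ / _ in Q0 IHn *.
(* Passing from n to n + 1 multiplies the bound by rho/2: one rho/4 pays for y D_n, the other for
   the quadratic term. *)
have -> : Q * (rho ^+ n.+1 * 2^-1 ^+ n.+1) =
   rho / 4 * (Q * (rho ^+ n * 2^-1 ^+ n)) + rho / 4 * (Q * (rho ^+ n * 2^-1 ^+ n)).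
  by rewrite !exprS; field.
rewrite lerD//; first by rewrite ler_pM.
case: n {IHn} => [|n].
  by rewrite mul0r mulr0 !expr0 !mulr1 mulr_ge0// divr_ge0// ltW.
(* The constant 16 in [Q] leaves exactly 2^(n+1) (rho/4)^n, so n + 1 <= 2^(n+1) suffices. *)
have -> : rho / 4 * (Q * (rho ^+ n.+1 * 2^-1 ^+ n.+1)) =
  (y - x) ^+ 2 * (2 ^+ n.+1 * (rho / 4) ^+ n).
  rewrite /Q.
  have -> : (4 : R) = 2 * 2 by ring.
  rewrite !exprMn !exprVn exprMn !exprS; field.
  by rewrite expf_neq0 gt_eqF.
rewrite ler_wpM2l// ler_pM ?exprn_ge0//; last first.
  by rewrite lerXn2r ?nnegrE// ltW// divr_gt0.
by rewrite -natrX ler_nat ltnW// ltn_expl.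
Qed.

Lemma derive1_expands_at u t a : expands_at u t a ->
  expands_at (u^`())%classic t (fun n => n.+1%:R *: a n.+1).
Proof.
move=> /expands_at_bound[rho [M [rho0 M0 aM cu]]].
pose a' n := n.+1%:R *: a n.+1.
(* With |x| and later the increment |h| both below rho/8, x + h stays within rho/4, where
   [exprn_second_order] applies. *)
apply/nbhs_ballP; exists (rho / 8); first by rewrite /= divr_gt0.
move=> t' /=; rewrite -ball_normE /= distrC; set x := t' - t => xrho.
have -> : t' = t + x by rewrite /x addrC subrK.
have xr : `|x| <= rho / 4 by lra.
(* Since n + 1 <= 2^n, the differentiated series at |x| <= rho/4 is still dominated by a geometric
   series of ratio 1/2. *)
have /cvg_ex[L cL] : cvgn (series (fun n => x ^+ n *: a' n)).
  apply: (@is_cvg_geometric_bound _ (M / rho)) => [|n].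
    by rewrite divr_ge0// ltW.
  rewrite /a' !normrZ normr_nat normrX /=.
  have -> : M / rho * 2^-1 ^+ n = (rho / 4) ^+ n * (2 ^+ n * (M / rho ^+ n.+1)).
    have -> : (4 : R) = 2 * 2 by ring.
    rewrite !expr_div_n !exprVn exprMn exprS; field.
    by rewrite !expf_neq0 ?gt_eqF.
  rewrite ler_pM ?exprn_ge0 ?mulr_ge0//.
    by rewrite lerXn2r ?nnegrE// divr_ge0// ltW.
  rewrite ler_pM//; last by rewrite ler_pdivlMr ?exprn_gt0.
  by rewrite -natrX ler_nat ltn_expl.
suff -> : (u^`())%classic (t + x) = L by [].
have quad y : `|y| <= rho / 4 ->
    `|u (t + y) - u (t + x) - (y - x) *: L| <=
    2 * (16 * M / rho ^+ 2) * (y - x) ^+ 2.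
  move=> yr.
  (* Differentiation kills the constant term, so N terms of the derived series match N + 1 terms of
     the original. *)
  have cv : (fun N => series (fun n => y ^+ n *: a n) N.+1 -
      series (fun n => x ^+ n *: a n) N.+1 -
      (y - x) *: series (fun n => x ^+ n *: a' n) N) @ \oo -->
      u (t + y) - u (t + x) - (y - x) *: L.
    apply: cvgB; last exact: cvgZr.
    apply: cvgB; first by rewrite (cvg_shiftS (series _)); apply: cu; lra.
    by rewrite (cvg_shiftS (series _)); apply: cu; lra.
  apply: (@cvg_norm_le _ _ _ 0%N cv) => N _.
  have -> : series (fun n => x ^+ n *: a' n) N =
      \sum_(0 <= n < N.+1) (n%:R * x ^+ n.-1) *: a n.
    rewrite big_nat_recl// mul0r scale0r add0r; apply: eq_bigr => n _.
    by rewrite /a' scalerA mulrC.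
  rewrite /series /= scaler_sumr -!sumrB -mulrA.
  apply: geometric_sum_bound => [|n].
    by rewrite mulr_ge0 ?sqr_ge0// divr_ge0 ?sqr_ge0// mulr_ge0.
  rewrite scalerA -!scalerBl normrZ.
  have D := ler_wpM2r (normr_ge0 (a n)) (exprn_second_order _ _ _ n rho0 xr yr).
  apply: le_trans D _.
  have -> : 16 * (y - x) ^+ 2 / rho ^+ 2 * (rho ^+ n * 2^-1 ^+ n) * `|a n| =
    16 * (y - x) ^+ 2 / rho ^+ 2 * 2^-1 ^+ n * (`|a n| * rho ^+ n) by ring.
  have -> : geometric (16 * M / rho ^+ 2 * (y - x) ^+ 2) 2^-1 n =
    16 * (y - x) ^+ 2 / rho ^+ 2 * 2^-1 ^+ n * M by rewrite /=; ring.
  rewrite ler_wpM2l// mulr_ge0 ?exprn_ge0 ?invr_ge0//.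
  by rewrite divr_ge0 ?sqr_ge0// mulr_ge0 ?sqr_ge0.
apply: cvg_lim; first exact: norm_hausdorff.
set K := 2 * _ in quad.
have K0 : 0 <= K by rewrite /K mulr_ge0// divr_ge0 ?sqr_ge0// mulr_ge0.
apply/cvgrPdist_le => e e0; near=> h.
have h0 : h != 0 by near: h; exact: nbhs_dnbhs_neq.
have hr : `|h| < rho / 8 by near: h; apply: dnbhs0_lt; rewrite divr_gt0.
(* Dividing by K + 1 rather than K covers K = 0. *)
have he : `|h| < e / (K + 1).
  by near: h; apply: dnbhs0_lt; rewrite divr_gt0// ltr_wpDl.
have /quad : `|h + x| <= rho / 4.
  by rewrite (le_trans (ler_normD _ _))//; lra.
rewrite addrK => q.
have -> : L - h^-1 *: (u (h + (t + x)) - u (t + x)) =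
   - (h^-1 *: (u (t + (h + x)) - u (t + x) - h *: L)).
  by rewrite addrCA [in RHS]scalerBr scalerA mulVf// scale1r opprB.
rewrite normrN normrZ normfV ler_pdivrMl ?normr_gt0//.
apply: le_trans q _; rewrite -[h ^+ 2]real_normK ?num_real//.
rewrite expr2 mulrCA ler_wpM2l//.
move: he; rewrite ltr_pdivlMr ?ltr_wpDl// => he.
by apply: le_trans (ltW he); rewrite mulrC ler_wpM2l// lerDl.
Unshelve. all: by end_near. Qed.

(** Each differentiation adds the factor n + 1 to the falling factorial. At n = 0 the coefficient is
    m! a_m, which with [expands_at_value] gives the m-th derivative at t. *)
Lemma derive1n_expands_at u t a (m : nat) : expands_at u t a ->
  expands_at (u^`(m))%classic t (fun n => ((n + m) ^_ m)%:R *: a (n + m)%N).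
Proof.
move=> ua; elim: m => [|m IHm].
  by under [X in expands_at _ _ X]funext do rewrite addn0 ffactn0 scale1r.
rewrite derive1nS.
have := derive1_expands_at _ _ _ IHm; congr expands_at.
apply/funext => n /=; rewrite scalerA -natrM mulnC addSnnS; congr (_%:R *: _).
by rewrite [RHS]ffactnSr -addSnnS addnK.
Qed.

End PowerSeries.

(** * Order of accuracy of a stencil from its moments *)

(** Expanding every u(t + x_l k) to order q, the moment conditions cancel all Taylor terms but the
    m-th, which becomes k^m u^(m)(t). Only the remainders are left. *)
Lemma stencil_derivative_bigO (R : realType) (X : completeNormedModType R)
    (I : eqType) (r : seq I) (w x : I -> R) (m q : nat) :
  (m < q)%N ->
  (forall n, (n < q)%N ->
    \sum_(l <- r) w l * x l ^+ n = if n == m then m`!%:R else 0) ->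
  forall (u : R -> X) (t : R) (a : nat -> X), expands_at u t a ->
  (fun=> (u^`(m))%classic t) =
    (fun k : R => k ^- m *: \sum_(l <- r) w l *: u (t + x l * k))
    +O_ (0^'+) (fun k : R => k ^+ (q - m)).
Proof.
move=> mq moment u t a ua.
have um : (u^`(m))%classic t = m`!%:R *: a m.
  have := expands_at_value _ _ _ (derive1n_expands_at _ _ _ m ua).
  by rewrite add0n ffactnn.
have [B [delta [delta0 rem]]] := taylor_remainder _ _ _ q ua.
pose Z := \sum_(l <- r) `|x l|.
have xZ l : l \in r -> `|x l| <= Z 
  by move=> lr; rewrite /Z (big_rem l lr) lerDl sumr_ge0.
have Z0 : 0 <= Z by exact: sumr_ge0.
pose K := \sum_(l <- r) `|w l| * (B * `|x l| ^+ q).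
apply/eqaddOP; near=> c; near=> k.
have k0 : 0 < k by near: k; exact: nbhs_right_gt.
(* [Z] dominates all nodes, so every x_l k falls in the range of [rem] at once. *)
have kZ : k * (Z + 1) <= delta.
  rewrite -ler_pdivlMr ?ltr_wpDl//.
  by near: k; apply: nbhs_right_le; rewrite divr_gt0// ltr_wpDl.
have -> : ((fun=> (u^`(m))%classic t) -
    (fun k : R => k ^- m *: \sum_(l <- r) w l *: u (t + x l * k))) k =
  - (k ^- m *: \sum_(l <- r) w l *:
      (u (t + x l * k) - \sum_(0 <= n < q) (x l * k) ^+ n *: a n)).
  rewrite -[LHS]/((u^`(m))%classic t -
    k ^- m *: \sum_(l <- r) w l *: u (t + x l * k)) um.
  under [in RHS]eq_bigr do rewrite scalerBr.
  rewrite sumrB scalerBr opprB; congr (_ - _).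
  under eq_bigr do rewrite scaler_sumr.
  rewrite exchange_big/=.
  have -> : \sum_(0 <= n < q) \sum_(l <- r) w l *: ((x l * k) ^+ n *: a n) =
      \sum_(0 <= n < q) (if n == m then k ^+ m *: (m`!%:R *: a m) else 0).
    apply: eq_big_nat => n /andP[_ nq].
    transitivity ((k ^+ n * \sum_(l <- r) w l * x l ^+ n) *: a n).
      rewrite mulr_sumr scaler_suml; apply: eq_bigr => l _.
      by rewrite scalerA exprMn; congr (_ *: _); ring.
    by rewrite moment//; case: eqP => [->|_]; rewrite ?mulr0 ?scale0r ?scalerA.
  rewrite -big_mkcond/= (big_nat1_eq _ _ m)/= mq.
  by rewrite scalerA mulVf ?scale1r// expf_neq0 ?gt_eqF.
rewrite normrN normrZ normfV !normrX gtr0_norm// ler_pdivrMl ?exprn_gt0//.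
rewrite mulrCA -exprD subnKC ?(ltnW mq)//.
apply: (@le_trans _ _ (K * k ^+ q)); last first.
  by rewrite ler_wpM2r ?exprn_ge0// ?ltW//; near: c; exact: nbhs_pinfty_gt.
apply: le_trans (ler_norm_sum _ _ _) _; rewrite mulr_suml.
rewrite big_seq [leRHS]big_seq; apply: ler_sum => l lr.
rewrite normrZ -mulrA ler_wpM2l//.
have -> : B * `|x l| ^+ q * k ^+ q = B * `|x l * k| ^+ q.
  by rewrite normrM exprMn [`|k|]gtr0_norm// mulrA.
apply: rem; rewrite normrM [`|k|]gtr0_norm// mulrC; apply: le_trans kZ.
by rewrite ler_wpM2l ?(ltW k0)// (le_trans (xZ _ lr))// lerDl.
Unshelve. all: by end_near. Qed.

(** * Weights of the forward differences and the final expansion *)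

Lemma difference_weights (R : realType) (m p : nat) (e : nat -> R) :
  (forall i, (m <= i)%N -> 0 < e i) ->
  exists d : nat -> R, forall n, (n <= p)%N ->
    \sum_(m <= i < p.+1) \sum_(0 <= j < i.+1)
      d i * ((-1) ^+ j * 'C(i, j)%:R) * ((i%:R - j%:R) * e i) ^+ n =
    if n == m then m`!%:R else 0.
Proof.
move=> e0.
(* This is the n-th moment of the undivided i-th forward difference of spacing [e i]: zero for n <
   i, and n! (e n)^n on the diagonal. *)
pose A n i := e i ^+ n *
  \sum_(0 <= j < i.+1) (-1) ^+ j * 'C(i, j)%:R * (i%:R - j%:R) ^+ n.
have A0 n i : (n < i)%N -> A n i = 0.
  by move=> ni; rewrite /A alternating_sum_expr 1?ltnW// ltn_eqF// mulr0.
have Ann n : (m <= n)%N -> A n n != 0.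
  move=> mn; rewrite /A alternating_sum_expr// eqxx.
  by rewrite mulf_neq0 ?expf_neq0 ?gt_eqF ?e0// ltr0n fact_gt0.
have [d dP] := lower_triangular_solve _ _
  (fun n => if n == m then m`!%:R else 0) _ p Ann.
exists d => n np.
transitivity (\sum_(m <= i < p.+1) d i * A n i).
  apply: eq_bigr => i _; rewrite /A mulrA mulr_sumr; apply: eq_bigr => j _.
  by rewrite exprMn; ring.
have [mn|nm] := leqP m n; last first.
  rewrite ltn_eqF// big_nat big1// => i /andP[mi _].
  by rewrite A0 ?mulr0// (leq_trans nm).
rewrite (@big_cat_nat _ _ _ n.+1) ?(leqW mn)//= dP ?mn//.
rewrite [X in _ + X]big_nat [X in _ + X]big1 ?addr0// => i /andP[ni _].
by rewrite A0 ?mulr0.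
Qed.

Theorem theorem8 (R : realType) (X : completeNormedModType R) (m p : nat)
  (hmp : (m <= p)%N) (eps : nat -> R)
  (heps : forall i : nat, (m < i)%N -> 0 < eps i) :
  exists C : forall i : nat, double_index i -> R,
  forall u : R -> X, analytic u -> forall t : R,
    ((fun=> (u^`(m))%classic t) =
       (fun k : R => k ^- m *: (\sum_(m <= i < p.+1)
         \sum_(alpha : double_index i | weight alpha == i)
           C i alpha *: (spacing m eps k i ^+ i *:
             finite_diff (spacing m eps k i) alpha u t)))
       +O_ (0^'+) (fun k : R => k ^+ (p.+1 - m)))
    /\
    (forall k : R, 0 < k ->
     forall i : nat, (m <= i <= p)%N ->
     forall alpha : double_index i, weight alpha = i ->
       spacing m eps k i ^+ i *: finite_diff (spacing m eps k i) alpha u t =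
       \sum_(0 <= j < i.+1) ((-1) ^+ j * 'C(i, j)%:R) *:
         u (t + ((alpha.1)%:R - j%:R) * spacing m eps k i)).
Proof.
(* Setting [e m] to 1 absorbs the exceptional spacing k_m = k. *)
pose e i := if i == m then 1 else eps i.
have e0 i : (m <= i)%N -> 0 < e i.
  by rewrite /e leq_eqVlt eq_sym; case: eqP => //= _ /heps.
have spacingE k i : spacing m eps k i = e i * k.
  by rewrite /spacing /e; case: eqP; rewrite ?mul1r.
have diffE u t k i (alpha : double_index i) :
    0 < k -> (m <= i)%N -> weight alpha = i ->
    spacing m eps k i ^+ i *: finite_diff (spacing m eps k i) alpha u t =
    \sum_(0 <= j < i.+1) ((-1) ^+ j * 'C(i, j)%:R) *:
      u (t + ((alpha.1)%:R - j%:R) * spacing m eps k i) :> X.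
  move=> k0 mi ai; have h0 : spacing m eps k i != 0.
    by rewrite spacingE mulf_neq0// gt_eqF// e0.
  have := @iter_diffE R X _ h0 alpha.1 alpha.2 u t.
  by rewrite -[(alpha.1 + alpha.2)%N]/(weight alpha) ai.
have [d dP] := @difference_weights R m p e e0.
(* In 'I_i.+1 the element [ord_max] is i, so this index is (i, 0). *)
exists (fun i alpha => if alpha == (ord_max, ord0) then d i else 0).
move=> u /[swap] t /(_ t)[a ua]; split; last first.
  by move=> k k0 i /andP[mi _] alpha; exact: diffE.
(* The double sum over orders i and nodes j is flattened into one stencil with nodes (i - j)
   [e i]. *)
pose r := [seq (i, j) | i <- index_iota m p.+1, j <- index_iota 0 i.+1].
pose w (l : nat * nat) : R := d l.1 * ((-1) ^+ l.2 * 'C(l.1, l.2)%:R).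
pose x (l : nat * nat) := (l.1%:R - l.2%:R) * e l.1.
have mom n : (n < p.+1)%N ->
    \sum_(l <- r) w l * x l ^+ n = if n == m then m`!%:R else 0.
  by rewrite ltnS => np; rewrite big_allpairs_dep dP.
have /eqaddOP H := @stencil_derivative_bigO R X _ r w x m p.+1 hmp mom u t a ua.
(* The estimate is transferred through an identity proved for k > 0, enough for a right
   neighbourhood of 0. *)
apply/eqaddOP; apply: filterS H => c; apply: filter_app; near=> k.
have k0 : 0 < k by near: k; exact: nbhs_right_gt.
suff E : \sum_(m <= i < p.+1) \sum_(alpha : double_index i | weight alpha == i)
    (if alpha == (ord_max, ord0) then d i else 0) *:
      (spacing m eps k i ^+ i *: finite_diff (spacing m eps k i) alpha u t) =
    \sum_(l <- r) w l *: u (t + x l * k).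
  rewrite -[X in `|X| <= _ -> _]/((u^`(m))%classic t -
    k ^- m *: \sum_(l <- r) w l *: u (t + x l * k)) -E; exact: id.
rewrite big_allpairs_dep; apply: eq_big_nat => i /andP[mi _].
rewrite (bigD1 (ord_max, ord0))/= ?/weight/= ?addn0// eqxx [X in _ + X]big1.
  rewrite addr0 diffE//=; last by rewrite /weight /= addn0.
  rewrite scaler_sumr; apply: eq_bigr => j _.
  by rewrite scalerA spacingE [(_ - _) * _]mulrA.
by move=> alpha /andP[_ /negbTE ->]; rewrite scale0r.
Unshelve. all: by end_near. Qed.
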